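(* There exist a sequence of strictly convex bounded domains $\Omega_n$ in the affine plane with smooth boundary, and for each $n$ four points $A_n,B_n,C_n,D_n\in\partial\Omega_n$ in counterclockwise cyclic order, such that the Hilbert areas $Vol_{\Omega_n}(A_nB_nC_nD_n)$ of the inscribed quadrilaterals (with vertices $A_n,B_n,C_n,D_n$) are uniformly bounded in $n$, while the bulging parameters diverge, i.e. $|v_n|\to\infty$ where $v_n$ is the bulge parameter of the flags formed by $A_n,B_n,C_n,D_n$ and the tangent lines to $\partial\Omega_n$ at these points.
   Context: For a quadrilateral with vertices $A,B,C,D$ (counterclockwise) on the boundary of a strictly convex domain with smooth boundary, let $a,b,c,d$ be the tangent lines at $A,B,C,D$. Edge parameters: the cross ratio of four collinear points is $\frac{(x_1-x_2)(x_3-x_4)}{(x_1-x_4)(x_2-x_3)}$ in an affine coordinate on the line; the cross ratio of four concurrent lines is that of their intersections with a general line. $Z\in(0,\infty)$ is the cross ratio of the lines $a,AB,AC,AD$ through $A$, and $W\in(0,\infty)$ is the cross ratio of the lines $c,CD,CA,CB$ through $C$. Twist and bulge parameters: a reference point $(Z_0,W_0)\in(0,\infty)^2$ is fixed once and for all; the $u$-twist multiplies $(Z,W)$ to $(e^{u}Z,e^{u}W)$ and the $v$-bulge changes $(Z,W)$ to $(e^{-3v}Z,e^{3v}W)$. The twist-bulge parameters $(u,v)\in\mathbb{R}^2$ of $(Z,W)$ are determined by $Z=e^{u-3v}Z_0$, $W=e^{u+3v}W_0$. Thus the bulge parameter diverges ($|v|\to\infty$) exactly when the ratio $Z/W$ leaves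 every compact subset of $(0,\infty)$. Hilbert area: for a bounded convex open set $\Omega$ in an affine plane with Euclidean norm $|\cdot|$, a tangent vector $v$ at $x\in\Omega$ has norm $\|v\|=\frac12\left(\frac1{|x-p|}+\frac1{|x-q|}\right)|v|$, where $p,q$ are the two intersection points with $\partial\Omega$ of the line through $x$ in direction $v$. For Borel $\mathcal{A}\subset\Omega$, $Vol_\Omega(\mathcal{A})=\int_{\mathcal{A}}\frac{\pi}{vol(B_x(1))}\,dvol(x)$, where $B_x(1)=\{v\in T_x\Omega:\|v\|<1\}$ and $vol$ is Lebesgue measure. The area of a quadrilateral means the area of its interior. *)

(* Defs.v *)
From HB Require Import structures.
From mathcomp Require Import all_boot all_order all_algebra.
From mathcomp Require Import all_classical all_reals all_analysis.
Set Implicit Arguments.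
Unset Strict Implicit.
Unset Printing Implicit Defensive.
Import Order.TTheory GRing.Theory Num.Theory.
Import numFieldNormedType.Exports.
Local Open Scope classical_set_scope.
Local Open Scope ring_scope.

Section Plane.
Context {R : realType}.

(* The norm `|_| of the library on R * R is the sup norm; the Euclidean norm
   has to be defined. *)
Definition enorm (v : R * R) : R := Num.sqrt (v.1 ^+ 2 + v.2 ^+ 2).

Definition det2 (v w : R * R) : R := v.1 * w.2 - v.2 * w.1.

Definition area2 : set (R * R) -> \bar R :=
  (@lebesgue_measure R \x @lebesgue_measure R)%E.

Definition line (p w : R * R) : set (R * R) :=
  [set x | exists t : R, x = p + t *: w].

Definition boundary (Omega : set (R * R)) : set (R * R) :=
  closure Omega `\` interior Omega.

(* Closed segments with endpoints in the closure meet the boundary at most at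
   their endpoints. As Omega is included in its closure, this contains the
   convexity of Omega. *)
Definition strictly_convex (Omega : set (R * R)) : Prop :=
  forall (p q : R * R) (t : R), closure Omega p -> closure Omega q ->
    p <> q -> 0 < t < 1 -> Omega ((1 - t) *: p + t *: q).

Definition smooth_near0 (delta : R) (f : R -> R) : Prop :=
  forall (k : nat) (s : R), `|s| < delta -> derivable (derive1n k f) s 1.

(* Near each boundary point, in suitable affine coordinates (s, t) centred at
   that point, Omega is the strict epigraph of a C^oo function. *)
Definition smooth_boundary (Omega : set (R * R)) : Prop :=
  forall p, boundary Omega p ->
    exists (e1 e2 : R * R) (delta eps : R) (f : R -> R),
      [/\ det2 e1 e2 != 0, 0 < delta, 0 < eps, smooth_near0 delta f &
        forall s t : R, `|s| < delta -> `|t| < eps ->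
          (Omega (p + s *: e1 + t *: e2) <-> f s < t)].

Definition smooth_strictly_convex_domain (Omega : set (R * R)) : Prop :=
  [/\ open Omega, Omega !=set0, bounded_set Omega,
      strictly_convex Omega & smooth_boundary Omega].

(* The line through p in the direction of a nonzero velocity, at p, of a curve
   drawn on the boundary. *)
Definition tangent_line (Omega : set (R * R)) (p : R * R)
    (l : set (R * R)) : Prop :=
  exists (gamma : R -> R * R) (w : R * R),
    [/\ gamma 0 = p, (\forall t \near (0 : R), boundary Omega (gamma t)),
        is_derive (0 : R) (1 : R) gamma w, w != 0 & l = line p w].

(* For points of the boundary of a convex domain, the counterclockwise cyclic
   order of three of them is the orientation of the triangle they span. *)
Definition ccw3 (A B C : R * R) : Prop := 0 < det2 (B - A) (C - A).

Definition ccw4 (A B C D : R * R) : Prop :=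
  [/\ ccw3 A B C, ccw3 A B D, ccw3 A C D & ccw3 B C D].

Definition cross_ratio (x1 x2 x3 x4 : R) : R :=
  ((x1 - x2) * (x3 - x4)) / ((x1 - x4) * (x2 - x3)).

(* z is the cross ratio of the lines l1, l2, l3, l4 concurrent at p: it is read
   on a transversal line q + R w, with affine coordinate x |-> q + x w. *)
Definition is_lines_cross_ratio (p : R * R) (l1 l2 l3 l4 : set (R * R))
    (z : R) : Prop :=
  [/\ l1 p, l2 p, l3 p & l4 p] /\
  exists (q w : R * R) (x1 x2 x3 x4 : R),
    [/\ w != 0, ~ line q w p,
        [/\ l1 (q + x1 *: w), l2 (q + x2 *: w),
            l3 (q + x3 *: w) & l4 (q + x4 *: w)] &
        z = cross_ratio x1 x2 x3 x4].

(* a and c are the tangent lines at A and C; line A (B - A) is the line AB. *)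
Definition edge_parameters (A B C D : R * R) (a c : set (R * R))
    (Z W : R) : Prop :=
  is_lines_cross_ratio A
    a (line A (B - A)) (line A (C - A)) (line A (D - A)) Z /\
  is_lines_cross_ratio C
    c (line C (D - C)) (line C (A - C)) (line C (B - C)) W.

Definition twist_bulge_parameters (Z0 W0 Z W u v : R) : Prop :=
  Z = expR (u - 3 * v) * Z0 /\ W = expR (u + 3 * v) * W0.

(* The point where the open ray issued from x in direction v meets the
   boundary; it is unique when x lies in a bounded convex open Omega and
   v != 0. *)
Definition ray_exit (Omega : set (R * R)) (x v : R * R) : R * R :=
  get [set p | boundary Omega p /\ exists2 t : R, 0 < t & p = x + t *: v].

(* For v = 0 the factor enorm v makes the value 0. *)
Definition hilbert_norm (Omega : set (R * R)) (x v : R * R) : R :=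
  let p := ray_exit Omega x v in
  let q := ray_exit Omega x (- v) in
  2^-1 * ((enorm (x - p))^-1 + (enorm (x - q))^-1) * enorm v.

Definition hilbert_unit_ball (Omega : set (R * R)) (x : R * R) :
    set (R * R) :=
  [set v | hilbert_norm Omega x v < 1].

Definition hilbert_area (Omega S : set (R * R)) : \bar R :=
  (\int[@lebesgue_measure R \x @lebesgue_measure R]_(x in S)
     ((pi : R)%:E / area2 (hilbert_unit_ball Omega x)))%E.

Definition quadrilateral (A B C D : R * R) : set (R * R) :=
  [set x | exists r1 r2 r3 r4 : R,
    [/\ [/\ 0 <= r1, 0 <= r2, 0 <= r3 & 0 <= r4], r1 + r2 + r3 + r4 = 1 &
        x = r1 *: A + r2 *: B + r3 *: C + r4 *: D]].

End Plane.

(* Main.v *)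
(** One fixed domain suffices: Omega = {x^4 + y^2 < 25}. The vertices A = (0,-5),
    B = (2,-3), C = (-2,-3) are fixed and D tends to A along the boundary, so
    that the quadrilaterals degenerate to an ideal triangle. With e = |x(D)|,
    the boundary is flat at A to order 4, so the angle at A between the tangent
    and AD is of order e^3 and Z ~ e^-3, while at C only the angle between CD and
    CA degenerates, so W ~ e^-1. Hence Z / W ~ e^-2 diverges.

    Area: let g = 25 - x^4 - y^2. For y <= -3 the unit ball at (x, y) contains a
    parallelogram adapted to the level line of g, of area comparable to
    g^(3/2) / (|x| + g^(1/4)), so the density is O(|x| g^(-3/2) + g^(-5/4)).
    Above a chord of the boundary over [a, b] with a, b of the same sign, g is at
    least 6 (height above the chord) + k^2 (x - a)(b - x) with k = max(|a|, |b|).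
    Integrating along vertical lines leaves O(1/k + 1/sqrt((x - a)(b - x))), whose
    integral over [a, b] is bounded independently of the chord. The quadrilateral
    is covered by the strips above its three lower edges CD, DA and AB. *)
Require Import Defs.
From HB Require Import structures.
From mathcomp Require Import all_boot all_order all_algebra.
From mathcomp Require Import all_classical all_reals all_analysis.
From mathcomp Require Import measurable_realfun.
From mathcomp Require Import ring lra.
Set Implicit Arguments.
Unset Strict Implicit.
Unset Printing Implicit Defensive.
Import Order.TTheory GRing.Theory Num.Theory.
Import numFieldNormedType.Exports.
Local Open Scope classical_set_scope.
Local Open Scope ring_scope.

(** * Integrals *)

(** The integral of a nonnegative function is a supremum over the simple functions below it, so the
    comparison applies to functions of unknown measurability such as the Hilbert density. *)
Lemma le_integral_ge0 d (T : measurableType d) (R : realType)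
    (mu : {measure set T -> \bar R}) (D E : set T) (f g : T -> \bar R) :
  (forall x, D x -> (0 <= f x)%E) -> (forall x, E x -> (0 <= g x)%E) ->
  (forall x, D x -> E x /\ (f x <= g x)%E) ->
  (\int[mu]_(x in D) f x <= \int[mu]_(x in E) g x)%E.
Proof.
move=> f0 g0 fg; rewrite !ge0_integralE//.
apply: ge_ereal_sup => _ [h hf <-].
apply: ereal_sup_ubound; exists h => // x; apply: (le_trans (hf x)).
rewrite /patch; case: ifPn => [|_]; last by case: ifPn => // /set_mem/g0.
by move=> /set_mem/fg[/mem_set -> ].
Qed.

(** The measure is an outer measure on all sets, so sections of Hilbert unit balls can be compared
    with intervals directly. *)
Lemma le_lebesgue_measure (R : realType) (A B : set R) :
  A `<=` B -> (lebesgue_measure A <= lebesgue_measure B)%E.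
Proof. by move=> AB; apply: le_outer_measure. Qed.

(** For improper integrals: [f] may blow up at both ends. The fundamental theorem of calculus is
    applied on compact subintervals exhausting []a, b[], and monotone convergence passes to the
    limit. *)
Lemma ge0_integral_itvoo_le (R : realType) (f F : R -> R) (a b M : R) :
  a < b ->
  (forall x, a < x < b -> is_derive x 1 F (f x)) ->
  (forall x, a < x < b -> {for x, continuous f}) ->
  (forall x, a < x < b -> 0 <= f x) ->
  (forall x y, a < x -> x < y -> y < b -> F y - F x <= M) ->
  (\int[@lebesgue_measure R]_(x in `]a, b[) (f x)%:E <= M%:E)%E.
Proof.
move=> ab dF cf f0 FM.
(* The shift by 3 makes [a + e n < b - e n] already for [n = 0]. *)
pose e n : R := (b - a) / (n + 3)%:R.
have e0 n : 0 < e n by rewrite divr_gt0 ?subr_gt0// ltr0n addnS.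
have ele n m : (n <= m)%N -> e m <= e n.
  move=> nm; rewrite ler_wpM2l ?subr_ge0 ?(ltW ab)// lef_pV2 ?posrE ?ltr0n ?addnS//.
  by rewrite ler_nat !ltnS leq_add2r.
have e3 n : e n <= (b - a) / 3 by apply: (ele 0%N).
pose I n := `[a + e n, b - e n]%classic.
have Isub n x : I n x -> a < x < b.
  by rewrite /I/= in_itv/=; have := e0 n; lra.
have -> : `]a, b[%classic = \bigcup_n I n.
  apply/seteqP; split => [x|x [n _ /Isub]]; last by rewrite /= in_itv.
  rewrite /= in_itv/= => /andP[ax xb].
  pose d := Num.min (x - a) (b - x).
  have d0 : 0 < d by rewrite lt_min !subr_gt0 ax.
  have : ((b - a) / d < (Num.truncn ((b - a) / d)).+1%:R).
    by rewrite truncnS_gt.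
  set n := (Num.truncn _).+1 => nlt; exists n => //.
  have : e n <= d.
    rewrite /e ler_pdivrMr ?ltr0n ?addnS// mulrC -ler_pdivrMr//.
    apply: (le_trans (ltW nlt)); by rewrite ler_nat addn0 -addn3 leq_addr.
  by rewrite /d le_min /I/= in_itv/= => /andP[? ?]; apply/andP; split; lra.
have cfi x : x \in `]a, b[ -> {for x, continuous f}.
  by rewrite in_itv/=; exact: cf.
have mf : measurable_fun `]a, b[ f.
  by apply: open_continuous_measurable_fun => // x; rewrite inE; exact: cfi.
have : (\int[@lebesgue_measure R]_(x in I n) (f x)%:E @[n --> \oo] -->
    \int[@lebesgue_measure R]_(x in \bigcup_n I n) (f x)%:E)%E.
  apply: ge0_nondecreasing_set_cvg_integral.
  - move=> n m nm; rewrite subsetEset => x.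
    rewrite /I/= !in_itv/= => /andP[? ?]; have := ele _ _ nm.
    by move=> ?; apply/andP; split; lra.
  - by move=> n; exact: measurable_itv.
  - move=> i; apply/measurable_EFinP; apply: measurable_funS mf => // x /Isub.
    by rewrite /= in_itv.
  - by move=> i x /Isub /f0; rewrite /= lee_fin.
move/cvg_lim => <- //.
apply: lime_le.
  apply: ereal_nondecreasing_is_cvgn => n m nm; apply: le_integral_ge0 => //.
  - by move=> x /Isub /f0; rewrite /= lee_fin.
  - by move=> x /Isub /f0; rewrite /= lee_fin.
  - move=> x; rewrite /I/= !in_itv/= => /andP[? ?]; have := ele _ _ nm.
    by move=> ?; split => //; apply/andP; split; lra.
apply: nearW => n.
have ne := e3 n; have ne0 := e0 n.
have lt_n : a + e n < b - e n by lra.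
have cF x : a < x < b -> {for x, continuous F}.
  by move=> /dF [dFx _]; apply/differentiable_continuous/derivable1_diffP.
rewrite (@continuous_FTC2 _ f F)//=.
- by rewrite -EFinB lee_fin FM//; lra.
- apply/continuous_in_subspaceT => x /set_mem /= /Isub; exact: cf.
- split.
  + by move=> x; rewrite in_itv/= => xab; have [] := dF x ltac:(lra).
  + apply: cvg_at_right_filter; apply: cF; lra.
  + apply: cvg_at_left_filter; apply: cF; lra.
- move=> x; rewrite in_itv/= => xab; have d := dF x ltac:(lra).
  by rewrite derive1E; exact: derive_val.
Qed.

Lemma is_derive1_powR_affine (R : realType) (c d p x : R) :
  0 < c * x + d ->
  is_derive x 1 (fun y => (c * y + d) `^ p) (p * c * (c * x + d) `^ (p - 1)).
Proof.
move=> h.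
have dl : is_derive x 1 (fun y => c * y + d) c.
  by apply: is_derive_eq; rewrite /GRing.scale/= mulr1 addr0.
have := @is_derive1_comp _ (fun z : R => z `^ p) _ x _ _ (is_derive1_powR p h) dl.
by move/is_derive_eq; apply; rewrite mulrAC.
Qed.

Lemma le_powR_neg (R : realType) (x y p : R) :
  0 < x -> x <= y -> p <= 0 -> y `^ p <= x `^ p.
Proof.
move=> x0 xy p0; have y0 := lt_le_trans x0 xy.
rewrite -[p]opprK powRN [x `^ _]powRN lef_pV2 ?posrE ?powR_gt0//.
by rewrite ge0_ler_powR ?nnegrE ?oppr_ge0 ?(ltW x0) ?(ltW y0).
Qed.

(** Integration along a vertical line, with [q] the gap at the chord. The antiderivative is
    nonpositive, so its increments are at most minus its value at [l], whatever the upper end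
    [m]. *)
Lemma integral_chord_slice (R : realType) (c q l m : R) : 0 <= c -> 0 < q ->
  (\int[@lebesgue_measure R]_(y in `]l, m[)
     (c * (6 * (y - l) + q) `^ (- (3 / 2)) + (6 * (y - l) + q) `^ (- (5 / 4)))%:E
   <= (c / 3 * q `^ (- 2^-1) + 2 / 3 * q `^ (- 4^-1))%:E)%E.
Proof.
move=> c0 q0; have [lm|ml] := ltP l m; last first.
  rewrite set_itv_ge ?bnd_simp -?leNgt// integral_set0 lee_fin.
  by rewrite addr_ge0 ?mulr_ge0 ?powR_ge0.
have E y : 6 * (y - l) + q = 6 * y + (q - 6 * l) by ring.
have pos y : l < y -> 0 < 6 * y + (q - 6 * l) by move=> ly; lra.
apply: (@ge0_integral_itvoo_le R (fun y => c * (6 * (y - l) + q) `^ (- (3 / 2)) +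
    (6 * (y - l) + q) `^ (- (5 / 4))) (fun y =>
  (- c / 3) * (6 * y + (q - 6 * l)) `^ (- 2^-1) +
  (- (2 / 3)) * (6 * y + (q - 6 * l)) `^ (- 4^-1))).
- exact: lm.
- move=> y /andP[ly ym]; rewrite E.
  have d1 := is_derive1_powR_affine (- 2^-1) (pos _ ly).
  have d2 := is_derive1_powR_affine (- 4^-1) (pos _ ly).
  apply: is_derive_eq; rewrite /GRing.scale/=.
  have -> : - 2^-1 - 1 = - (3 / 2) :> R by lra.
  have -> : - 4^-1 - 1 = - (5 / 4) :> R by lra.
  by field.
- move=> y /andP[ly ym].
  have dd p : {for y, continuous (fun y => (6 * (y - l) + q) `^ p)}.
    under [X in {for _, continuous X}]eq_fun do rewrite E.
    have [+ _] := is_derive1_powR_affine p (pos _ ly).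
    by move/derivable1_diffP/differentiable_continuous.
  by apply: cvgD; [apply: cvgMr|]; exact: dd.
- by move=> y _; rewrite addr_ge0 ?mulr_ge0 ?powR_ge0.
- move=> x y lx xy ym.
  have ge0 (z p : R) : 0 <= z `^ p by exact: powR_ge0.
  have Y1 := mulr_ge0 c0 (ge0 (6 * y + (q - 6 * l)) (- 2^-1)).
  have Y2 := ge0 (6 * y + (q - 6 * l)) (- 4^-1).
  have X1 := mulr_ge0 c0 (ge0 (6 * x + (q - 6 * l)) (- 2^-1)).
  have X2 := ge0 (6 * x + (q - 6 * l)) (- 4^-1).
  have Q1 : c * (6 * x + (q - 6 * l)) `^ (- 2^-1) <= c * q `^ (- 2^-1).
    by rewrite ler_wpM2l// le_powR_neg//; lra.
  have Q2 : (6 * x + (q - 6 * l)) `^ (- 4^-1) <= q `^ (- 4^-1).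
    by apply: le_powR_neg => //; lra.
  lra.
Qed.

(* The second summand is the derivative of asin ((2 x - a - b) / (b - a)). *)
Lemma integral_arcsine_le (R : realType) (a b c : R) : a < b -> 0 <= c ->
  (\int[@lebesgue_measure R]_(x in `]a, b[)
     (c + (Num.sqrt ((x - a) * (b - x)))^-1)%:E <= (c * (b - a) + pi)%:E)%E.
Proof.
move=> ab c0.
have ba0 : 0 < b - a by rewrite subr_gt0.
pose u x := (2 / (b - a)) * x - (a + b) / (b - a).
have uE x : 1 - u x ^+ 2 = (2 / (b - a)) ^+ 2 * ((x - a) * (b - x)).
  by rewrite /u; field; lra.
have u1 x : a < x < b -> -1 < u x < 1.
  move=> /andP[ax xb]; have : 0 < 1 - u x ^+ 2.
    by rewrite uE mulr_gt0 ?exprn_gt0 ?divr_gt0 ?mulr_gt0// subr_gt0.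
  by move=> ?; apply/andP; split; nra.
have w0 x : a < x < b -> 0 < (x - a) * (b - x).
  by move=> /andP[ax xb]; rewrite mulr_gt0 ?subr_gt0.
apply: (@ge0_integral_itvoo_le R
  (fun x => c + (Num.sqrt ((x - a) * (b - x)))^-1) (fun x => c * x + asin (u x))).
- exact: ab.
- move=> x xab.
  have du : is_derive x 1 u (2 / (b - a)).
    by apply: is_derive_eq; rewrite /GRing.scale/= mulr1 subr0.
  have da := @is_derive1_comp _ _ _ x _ _ (is_derive1_asin (u1 _ xab)) du.
  have := is_deriveD (is_deriveZ c (is_derive_id x 1)) da.
  move=> /is_derive_eq; apply.
  rewrite /GRing.scale/= mulr1 uE sqrtrM ?sqr_ge0// sqrtr_sqr gtr0_norm ?divr_gt0//.
  congr (_ + _); rewrite invfM; field; rewrite gt_eqF ?sqrtr_gt0 ?w0//=.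
  by rewrite gt_eqF.
- move=> x xab; apply: cvgD; first exact: cvg_cst.
  apply: cvgV; first by rewrite gt_eqF// sqrtr_gt0 w0.
  apply: (@continuous_comp _ _ _ (fun x => (x - a) * (b - x)) Num.sqrt).
    by apply: cvgM; apply: cvgB; (exact: cvg_cst || exact: cvg_id).
  exact: sqrt_continuous.
- by move=> x xab; rewrite addr_ge0 ?invr_ge0 ?sqrtr_ge0.
(* The inverse sine contributes at most the length [pi] of its range. *)
- move=> x y ax xy yb.
  have /andP[? ?] := u1 x ltac:(lra); have /andP[? ?] := u1 y ltac:(lra).
  have : asin (u y) <= pi / 2 by apply: asin_lepi2; lra.
  have : - (pi / 2) <= asin (u x) by apply: asin_geNpi2; lra.
  nra.
Qed.

(** * Integration over the strip above a chord *)

(* A lower bound for 25 - x^4 - y^2 above a chord y = l1 x + l0 of its zero set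
   over [a, b]: the slope in y is at least 6 for y <= -3, and the second summand
   bounds the value on the chord. *)
Definition strip_gap (R : realType) (a b k l0 l1 : R) (z : R * R) : R :=
  6 * (z.2 - (l1 * z.1 + l0)) + k ^+ 2 * ((z.1 - a) * (b - z.1)).

Definition strip_density (R : realType) (a b k l0 l1 : R) (z : R * R) : R :=
  `|z.1| * strip_gap a b k l0 l1 z `^ (- (3 / 2)) +
  strip_gap a b k l0 l1 z `^ (- (5 / 4)).

(** Closed in the first coordinate, so that strips over consecutive chords also cover the vertical
    line through the common endpoint. *)
Definition strip (R : realType) (a b m l0 l1 : R) : set (R * R) :=
  [set z | a <= z.1 <= b /\ l1 * z.1 + l0 < z.2 < m].

Lemma strip_density_ge0 (R : realType) (a b k l0 l1 : R) z :
  0 <= strip_density a b k l0 l1 z.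
Proof. by rewrite addr_ge0 ?mulr_ge0 ?powR_ge0. Qed.

Lemma measurable_above_line (R : realType) (l0 l1 : R) :
  measurable_fun [set: R * R] (fun z : R * R => z.2 - (l1 * z.1 + l0)).
Proof.
have m1 : measurable_fun [set: R * R] (fst : R * R -> R) := measurable_fst.
have m2 : measurable_fun [set: R * R] (snd : R * R -> R) := measurable_snd.
by apply: measurable_funB => //; apply: measurable_funD => //;
  apply: measurable_funM.
Qed.

Lemma measurable_strip (R : realType) (a b m l0 l1 : R) :
  measurable (strip a b m l0 l1).
Proof.
have m1 : measurable_fun [set: R * R] (fst : R * R -> R) := measurable_fst.
have m2 : measurable_fun [set: R * R] (snd : R * R -> R) := measurable_snd.
have ml := measurable_above_line l0 l1.
rewrite (_ : strip _ _ _ _ _ = fst @^-1` `[a, b] `&`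
    ((fun z : R * R => z.2 - (l1 * z.1 + l0)) @^-1` `]0, +oo[ `&`
     snd @^-1` `]-oo, m[)); last first.
  apply/seteqP; split => z; rewrite /strip/= !in_itv/= andbT subr_gt0.
    by move=> [-> /andP[-> ->]].
  by move=> [-> [-> ->]].
apply: measurableI; first by rewrite -[X in measurable X]setTI; exact: m1.
apply: measurableI; first by rewrite -[X in measurable X]setTI; exact: ml.
by rewrite -[X in measurable X]setTI; exact: m2.
Qed.

Lemma measurable_strip_density (R : realType) (a b k l0 l1 : R) :
  measurable_fun [set: R * R] (strip_density a b k l0 l1).
Proof.
have m1 : measurable_fun [set: R * R] (fst : R * R -> R) := measurable_fst.
have mq : measurable_fun setT (strip_gap a b k l0 l1).
  apply: measurable_funD; apply: measurable_funM => //.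
    exact: measurable_above_line.
  by apply: measurable_funM; apply: measurable_funB.
have mqp p : measurable_fun setT (fun z => strip_gap a b k l0 l1 z `^ p).
  exact: (measurableT_comp (measurable_powR p) mq).
apply: measurable_funD => //; apply: measurable_funM => //.
exact: (measurableT_comp (@normr_measurable R setT) m1).
Qed.

Lemma measurable_strip_density_patch (R : realType) (a b k m l0 l1 : R) :
  measurable_fun [set: R * R]
    ((fun z => (strip_density a b k l0 l1 z)%:E) \_ (strip a b m l0 l1)).
Proof.
have [+ _] := measurable_restrictT (fun z => (strip_density a b k l0 l1 z)%:E)
  (measurable_strip a b m l0 l1); apply.
apply/measurable_EFinP; apply: measurable_funTS; exact: measurable_strip_density.
Qed.

(** Tonelli's theorem, with slices bounded by [1/k] plus the arcsine density. The outer integral is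
    then at most [(b - a) / k + pi], and [b - a <= k] makes this independent of the chord. *)
Lemma integral_chord_strip (R : realType) (a b k m l0 l1 : R) :
  a < b -> 0 < k -> b - a <= k -> (forall x, a < x < b -> `|x| <= k) ->
  (\int[@lebesgue_measure R \x @lebesgue_measure R]_(z in strip a b m l0 l1)
     (strip_density a b k l0 l1 z)%:E <= (1 + pi)%:E)%E.
Proof.
move=> ab k0 bak xk.
set S := strip a b m l0 l1; set G := strip_density a b k l0 l1.
have G0 z : 0 <= G z := strip_density_ge0 _ _ _ _ _ z.
have mGS := measurable_strip_density_patch a b k m l0 l1.
rewrite integral_mkcond fubini_tonelli1; last 2 first.
- exact: mGS.
- by move=> z; apply: erestrict_ge0 => z' _; rewrite lee_fin; exact: G0.
set F := fubini_F _ _.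
have F0 x : (0 <= F x)%E.
  apply: integral_ge0 => y _; apply: erestrict_ge0 => z _; rewrite lee_fin.
  exact: G0.
have mF : measurable_fun setT F.
  apply: measurable_fun_fubini_tonelli_F.
    exact: mGS.
  by move=> z; apply: erestrict_ge0 => z' _; rewrite lee_fin; exact: G0.
have Fout x : ~ (a <= x <= b) -> F x = 0%E.
  move=> xab; apply: integral0_eq => y _; rewrite patchE ifF//.
  by apply/negbTE/negP => /set_mem[].
have Fle x : a < x < b -> (F x <= (k^-1 + (Num.sqrt ((x - a) * (b - x)))^-1)%:E)%E.
  move=> /andP[ax xb]; set w := (x - a) * (b - x).
  have w0 : 0 < w by rewrite mulr_gt0 ?subr_gt0.
  have s0 : 0 < Num.sqrt w by rewrite sqrtr_gt0.
  set s := Num.sqrt w in s0 *.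
  pose l := l1 * x + l0.
  have -> : F x = (\int[@lebesgue_measure R]_(y in `]l, m[)
      (`|x| * (6 * (y - l) + k ^+ 2 * w) `^ (- (3 / 2)) +
       (6 * (y - l) + k ^+ 2 * w) `^ (- (5 / 4)))%:E)%E.
    rewrite [RHS]integral_mkcond; apply: eq_integral => y _.
    rewrite !patchE/=; congr (if _ then _ else _).
    apply/idP/idP => /set_mem H; apply/mem_set; move: H; rewrite /S /strip/= in_itv/=.
      by case.
    by move=> ->; rewrite (ltW ax) (ltW xb).
  apply: (le_trans (integral_chord_slice _ _ _ _)) => //.
    by rewrite mulr_gt0// exprn_gt0.
  rewrite lee_fin.
  have -> : k ^+ 2 * w = (k * s) ^+ 2.
    by rewrite exprMn sqr_sqrtr// ltW.
  have ks0 : 0 < k * s by rewrite mulr_gt0.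
  have -> : ((k * s) ^+ 2) `^ (- 2^-1) = (k * s)^-1.
    by rewrite powRN powR12_sqrt ?sqr_ge0// sqrtr_sqr gtr0_norm.
  have -> : ((k * s) ^+ 2) `^ (- 4^-1) = (Num.sqrt (k * s))^-1.
    have e4 : 2%:R * 4^-1 = 2^-1 :> R by field.
    by rewrite powRN -(@powR_mulrn _ (k * s) 2) ?ltW// -powRrM e4 powR12_sqrt ?ltW.
  rewrite invfM (_ : `|x| / 3 * _ = (`|x| / k) / 3 * s^-1); last first.
    by field; rewrite !gt_eqF.
  have h1 : `|x| / k <= 1 by rewrite ler_pdivrMr// mul1r xk// ax.
  have k'0 : 0 < k^-1 by rewrite invr_gt0.
  have s'0 : 0 < s^-1 by rewrite invr_gt0.
  have r2 : (Num.sqrt (k * s))^-1 ^+ 2 = k^-1 * s^-1.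
    by rewrite exprVn sqr_sqrtr ?ltW// invfM.
  have r0 : 0 < (Num.sqrt (k * s))^-1 by rewrite invr_gt0 sqrtr_gt0.
  (* The arithmetic-geometric mean inequality separates the constant [1/k] from the arcsine density
     [1/s]. *)
  have amgm : 2 * (Num.sqrt (k * s))^-1 <= k^-1 + s^-1.
    rewrite -ler_sqr ?nnegrE ?addr_ge0 ?mulr_ge0 ?(ltW k'0) ?(ltW s'0) ?(ltW r0)//.
    by rewrite exprMn r2 -subr_ge0 (_ : _ - _ = (k^-1 - s^-1) ^+ 2) ?sqr_ge0//; ring.
  have h2 : `|x| / k * s^-1 <= s^-1 by rewrite ler_piMl ?(ltW s'0).
  lra.
(* The two end slices, where the gap vanishes on the chord and the integral may be infinite, form a
   null set. *)
rewrite (_ : (\int[_]_x _)%E = (\int[@lebesgue_measure R]_(x in `]a, b[) F x)%E);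
  last first.
  rewrite -(@integral_itv_bndoo _ _ _ _ true false); last exact: measurable_funTS.
  rewrite [RHS]integral_mkcond; apply: eq_integral => x _.
  rewrite patchE; case: ifPn => // /negP xab; apply: Fout => h; apply: xab.
  by apply/mem_set; rewrite /= in_itv.
apply: (@le_trans _ _ (k^-1 * (b - a) + pi)%:E).
  apply: le_trans (integral_arcsine_le ab _); last by rewrite invr_ge0 ltW.
  apply: le_integral_ge0 => [x _//|x _|x xab].
    by rewrite lee_fin addr_ge0 ?invr_ge0 ?sqrtr_ge0// ltW.
  by split => //; apply: Fle; move: xab; rewrite /= in_itv.
by rewrite lee_fin lerD2r mulrC ler_pdivrMr// mul1r.
Qed.

(** * The domain x^4 + y^2 < 25 *)

Section QuarticDomain.
Context {R : realType}.
Implicit Types (z p q v : R * R).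

Definition quartic z : R := z.1 ^+ 4 + z.2 ^+ 2.

Definition quartic_domain : set (R * R) := [set z | quartic z < 25].

Local Notation Om := quartic_domain.

Lemma continuous_quartic : continuous quartic.
Proof.
move=> z; apply: cvgD.
  apply: (@continuous_comp _ _ _ fst (fun x : R => x ^+ 4)); first exact: cvg_fst.
  exact: exprn_continuous.
apply: (@continuous_comp _ _ _ snd (fun x : R => x ^+ 2)); first exact: cvg_snd.
exact: exprn_continuous.
Qed.

(** The convexity defects of [x^4] and [y^2] are written as [t (1 - t)] times nonnegative
    expressions. If the abscissas differ, one of them is nonzero and the quartic defect is positive;
    otherwise the ordinates differ and the quadratic one is. *)
Lemma quartic_strictly_convex p q (t : R) : p <> q -> 0 < t < 1 ->
  quartic ((1 - t) *: p + t *: q) < (1 - t) * quartic p + t * quartic q.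
Proof.
case: p q => [a b] [c d] pq /andP[t0 t1]; rewrite /quartic/= /GRing.scale/=.
set x := (1 - t) * a + t * c; set y := (1 - t) * b + t * d.
have ty : 0 < t * (1 - t) by rewrite mulr_gt0 ?subr_gt0.
have y2 : y ^+ 2 = (1 - t) * b ^+ 2 + t * d ^+ 2 - t * (1 - t) * (b - d) ^+ 2.
  by rewrite /y; ring.
have x4 : x ^+ 4 = (1 - t) * a ^+ 4 + t * c ^+ 4 -
    t * (1 - t) * ((a ^+ 2 - c ^+ 2) ^+ 2 + (a - c) ^+ 2 *
      ((1 - t) * a ^+ 2 + t * c ^+ 2 + x ^+ 2)).
  by rewrite /x; ring.
have [ac|ac] := eqVneq a c.
  have bd : b - d != 0.
    by rewrite subr_eq0; apply/eqP => bd; apply: pq; rewrite ac bd.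
  have : 0 < (b - d) ^+ 2 by rewrite exprn_even_gt0.
  by move=> /(mulr_gt0 ty); rewrite y2 x4 ac; lra.
have : 0 < (a - c) ^+ 2 by rewrite exprn_even_gt0//= subr_eq0.
have : 0 < (1 - t) * a ^+ 2 + t * c ^+ 2.
  have := sqr_ge0 a; have := sqr_ge0 c; have [a0|a0] := eqVneq a 0.
    have : 0 < c ^+ 2 by rewrite exprn_even_gt0//= eq_sym -a0.
    by move=> *; nra.
  have : 0 < a ^+ 2 by rewrite exprn_even_gt0.
  by move=> *; nra.
move=> h1 h2; have h3 : 0 < (a - c) ^+ 2 * ((1 - t) * a ^+ 2 + t * c ^+ 2 + x ^+ 2).
  by rewrite mulr_gt0// ltr_wpDr// sqr_ge0.
have h4 := sqr_ge0 (a ^+ 2 - c ^+ 2).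
have := mulr_gt0 ty (ltr_wpDl h4 h3).
have := mulr_ge0 (ltW ty) (sqr_ge0 (b - d)).
by rewrite y2 x4; lra.
Qed.

Lemma open_quartic_domain : open Om.
Proof.
rewrite (_ : Om = quartic @^-1` `]-oo, 25[); last first.
  by apply/seteqP; split => z; rewrite /Om/= in_itv.
by apply: open_comp; [move=> z _; exact: continuous_quartic|exact: interval_open].
Qed.

Lemma closure_quartic_domain p : closure Om p -> quartic p <= 25.
Proof.
have cl : closed (quartic @^-1` `]-oo, 25]).
  by apply: closed_comp; [move=> z _; exact: continuous_quartic|exact: interval_closed].
move=> /(@closure_subset _ Om (quartic @^-1` `]-oo, 25])) h.
rewrite -[_ <= _]/((quartic p \in `]-oo, 25])) .
have := h _; rewrite -(proj1 (closure_id _) cl); apply => z.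
by rewrite /Om/= in_itv/= => /ltW.
Qed.

Lemma quartic_domain_norm z : Om z -> `|z| < 5.
Proof.
rewrite /Om /quartic/= => h; rewrite prod_normE gt_max !ltr_norml.
have := sqr_ge0 z.2; have := sqr_ge0 (z.1 ^+ 2 - 25 / 2) => h1 h2.
have e : z.1 ^+ 4 = z.1 ^+ 2 ^+ 2 by rewrite -exprM.
have h3 : z.1 ^+ 2 < 25 by rewrite e in h; nra.
have h4 : z.2 ^+ 2 < 25 by have := sqr_ge0 (z.1 ^+ 2); rewrite e in h; lra.
by apply/andP; split; apply/andP; split; nra.
Qed.

(** The points [t *: p] with [t < 1] tend to [p] and lie in the domain, by strict convexity between
    0 and [p]. *)
Lemma level_closure_quartic_domain p : quartic p = 25 -> closure Om p.
Proof.
move=> p25 B pB.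
have cc : {for 1, continuous (fun t : R => t *: p)}.
  by move=> ?; apply: scalel_continuous.
have : \forall t \near (1 : R)^'-, B (t *: p).
  by apply: cvg_at_left_filter cc _ _; rewrite scale1r.
move=> nB.
near (1 : R)^'- => t.
exists (t *: p); split; last by near: t.
have t1 : t < 1 by near: t; exact: nbhs_left_lt.
have t0 : 0 < t by near: t; exact: nbhs_left_gt.
have p0 : p <> 0 by move=> p0; move: p25; rewrite /quartic p0/= !expr0n/=; lra.
have := @quartic_strictly_convex 0 p t (nesym p0).
rewrite scaler0 add0r t0 t1 p25 => /(_ isT).
by rewrite /Om/= {2}/quartic/= !expr0n/=; lra.
Unshelve. all: by end_near. Qed.

Lemma boundary_quartic_domain p : boundary Om p <-> quartic p = 25.
Proof.
rewrite /boundary (proj1 (interior_id _) open_quartic_domain); split.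
  by move=> [/closure_quartic_domain + /negP]; rewrite /= -leNgt; lra.
by move=> p25; split; [exact: level_closure_quartic_domain|rewrite /Om/= p25 ltxx].
Qed.

Lemma quartic_domain_strictly_convex : strictly_convex Om.
Proof.
move=> p q t /closure_quartic_domain p25 /closure_quartic_domain q25 pq t01.
by have := quartic_strictly_convex pq t01; rewrite /Om/=; nra.
Qed.

Lemma quartic_domain_bounded : bounded_set Om.
Proof.
exists 5; split => // M M5 z /quartic_domain_norm/ltW z5.
by apply: (le_trans z5); exact: ltW.
Qed.

Lemma enormZ (t : R) v : enorm (t *: v) = `|t| * enorm v.
Proof.
rewrite /enorm/= /GRing.scale/= !exprMn -mulrDr sqrtrM ?sqr_ge0//.
by rewrite sqrtr_sqr.
Qed.

Lemma enorm_gt0 v : v != 0 -> 0 < enorm v.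
Proof.
case: v => a b ab; rewrite sqrtr_gt0/= lt0r addr_ge0 ?sqr_ge0// andbT.
by rewrite paddr_eq0 ?sqr_ge0// !sqrf_eq0 -xpair_eqE.
Qed.

(** As [ray_exit] is a choice, an exit point must first be produced, here by the intermediate value
    theorem. Its parameter exceeds 1, since convexity keeps the segment from [z] to [z + v] inside
    the domain. *)
Lemma ray_exit_quartic_domain z v : Om z -> Om (z + v) -> v != 0 ->
  exists2 t : R, 1 < t & ray_exit Om z v = z + t *: v.
Proof.
move=> Oz Ozv v0.
have nv0 : 0 < `|v| by rewrite normr_gt0.
have : exists p, boundary Om p /\ exists2 t : R, 0 < t & p = z + t *: v.
  (* By the triangle inequality [z + T *: v] has norm at least 5, hence is outside the domain. *)
  pose T := (`|z| + 5) / `|v|.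
  have T0 : 0 < T by rewrite divr_gt0// ltr_wpDl.
  have FT : 25 <= quartic (z + T *: v).
    rewrite leNgt; apply/negP => /quartic_domain_norm.
    have := lerB_normD (T *: v) z; rewrite [T *: v + z]addrC normrZ gtr0_norm// divfK ?gt_eqF//.
    lra.
  have cF : continuous (fun t : R => quartic (z + t *: v)).
    move=> t; apply: (@continuous_comp _ _ _ (fun t : R => z + t *: v) quartic).
      by apply: cvgD; [exact: cvg_cst|apply: scalel_continuous].
    exact: continuous_quartic.
  have [||t] := @IVT R (fun t => quartic (z + t *: v)) 0 T 25 (ltW T0).
  - exact: continuous_subspaceT.
  - rewrite scale0r addr0 ge_min le_max FT orbT andbT.
    by move: Oz; rewrite /Om/= => /ltW ->.
  rewrite in_itv/= => /andP[t0 _] Ft.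
  exists (z + t *: v); split; first exact/boundary_quartic_domain.
  exists t => //; rewrite lt0r t0 andbT; apply/eqP => t00.
  by move: Oz Ft; rewrite t00 scale0r addr0 /Om/= => /[swap] ->; rewrite ltxx.
move=> /getPex; rewrite -/(ray_exit Om z v).
move=> [/boundary_quartic_domain e [t t0 pe]]; exists t => //.
rewrite ltNge; apply/negP => t1.
have : Om (z + t *: v).
  have [->|tn1] := eqVneq t 1; first by rewrite scale1r.
  have -> : z + t *: v = (1 - t) *: z + t *: (z + v).
    by rewrite scalerBl scale1r scalerDr addrA subrK.
  apply: quartic_domain_strictly_convex; rewrite ?t0 ?lt_neqAle ?tn1//.
  - exact: subset_closure.
  - exact: subset_closure.
  - by move=> /(congr1 (fun p => p - z)); rewrite subrr addrAC subrr add0r => /esym/eqP; apply/negP.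
by rewrite -pe /Om/= e ltxx.
Qed.

(** With exit parameters [t, s > 1] in the directions [v] and [- v], the Hilbert norm is
    [(1/t + 1/s) / 2 < 1]. Lower bounds on the ball thus reduce to membership of two points in the
    domain. *)
Lemma hilbert_unit_ball_quartic_domain z v :
  Om z -> Om (z + v) -> Om (z - v) -> hilbert_unit_ball Om z v.
Proof.
move=> Oz Op Om'; rewrite /hilbert_unit_ball/= /hilbert_norm/=.
have [->|v0] := eqVneq v 0.
  by rewrite /enorm/= !expr0n/= addr0 sqrtr0 mulr0.
have [t t1 ->] := ray_exit_quartic_domain Oz Op v0.
have [s s1 ->] := ray_exit_quartic_domain Oz Om' ltac:(by rewrite oppr_eq0).
have e (r : R) w : z - (z + r *: w) = (- r) *: w.
  by rewrite opprD addrA subrr add0r scaleNr.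
rewrite !e scalerN -scaleNr opprK !enormZ normrN !gtr0_norm; try lra.
have ev := enorm_gt0 v0.
rewrite -mulrA mulrDl !invfM.
rewrite -!mulrA mulVf ?gt_eqF// !mulr1.
have : t^-1 < 1 by rewrite invf_lt1//; lra.
have : s^-1 < 1 by rewrite invf_lt1//; lra.
lra.
Qed.

End QuarticDomain.

(** * Upper bound for the density of the Hilbert area *)

Section QuarticDensity.
Context {R : realType}.
Implicit Types (z p q v : R * R).
Local Notation Om := (@quartic_domain R).

(* Each term of the expansion of quartic (z + v) - quartic z, the first-order one
   being the quantity bounded by s^4 / 4, is a small fraction of s^4. *)
Lemma quartic_domain_add z v (s : R) :
  0 < s -> s ^+ 4 = 25 - quartic z -> z.2 <= - 3 ->
  `|z.1| * `|v.1| <= s ^+ 2 / 10 -> `|v.1| <= s / 10 ->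
  `|2 * z.2 * v.2 + 4 * z.1 ^+ 3 * v.1| <= s ^+ 4 / 4 ->
  Om (z + v).
Proof.
case: z v => x y [a b]; rewrite /Om /quartic/= => s0 sg y3 xa a_s w_s.
set w := 2 * y * b + _ in w_s *.
have sql (u c : R) : `|u| <= c -> u ^+ 2 <= c ^+ 2.
  by move=> uc; rewrite -real_normK ?num_real// ler_sqr ?nnegrE// (le_trans _ uc).
(* From [y <= - 3], the quantity [y^2] is at least 9, which leaves at most 16 for [x^4]; the same
   argument bounds [s^4]. *)
have x16 : x ^+ 4 <= 16 by have := exprn_gt0 4 s0; nra.
have s4 : s ^+ 4 = s ^+ 2 * s ^+ 2 by ring.
have x4E : x ^+ 4 = x ^+ 2 * x ^+ 2 by ring.
have x4 : x ^+ 2 <= 4 by have := sqr_ge0 x; nra.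
have s24 : s ^+ 2 <= 4 by have := sqr_ge0 s; have := sqr_ge0 (x ^+ 2); nra.
have s20 : 0 < s ^+ 2 by rewrite exprn_gt0.
have xa2 : (x * a) ^+ 2 <= s ^+ 4 / 100.
  have -> : s ^+ 4 / 100 = (s ^+ 2 / 10) ^+ 2 by field.
  by apply: sql; rewrite normrM.
have a2 : a ^+ 2 <= s ^+ 2 / 100.
  have -> : s ^+ 2 / 100 = (s / 10) ^+ 2 by field.
  exact: sql.
have a4 : a ^+ 4 <= s ^+ 4 / 10000.
  have -> : a ^+ 4 = a ^+ 2 * a ^+ 2 by ring.
  have -> : s ^+ 4 / 10000 = (s ^+ 2 / 100) * (s ^+ 2 / 100) by field.
  by rewrite ler_pM// sqr_ge0.
have xa' : `|x * a| <= s ^+ 2 / 10 by rewrite normrM.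
have xa3 : 4 * x * a ^+ 3 <= s ^+ 4 / 250.
  have -> : 4 * x * a ^+ 3 = 4 * (x * a * a ^+ 2) by ring.
  have : x * a * a ^+ 2 <= s ^+ 2 / 10 * (s ^+ 2 / 100).
    rewrite (le_trans (ler_norm _))// normrM [`|a ^+ 2|]ger0_norm ?sqr_ge0//.
    by rewrite ler_pM// sqr_ge0.
  lra.
have x3a : `|4 * x ^+ 3 * a| <= 16 * (s ^+ 2 / 10).
  have -> : 4 * x ^+ 3 * a = (4 * x ^+ 2) * (x * a) by ring.
  rewrite normrM ler_pM// ger0_norm; last by rewrite mulr_ge0// sqr_ge0.
  lra.
have ws2 : `|w| <= s ^+ 2 by rewrite (le_trans w_s)//; nra.
(* Here [6 |b| <= |2 y b| <= s^2 + (16 / 10) s^2]. *)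
have b_s : `|b| <= s ^+ 2 * (13 / 30).
  have h : `|2 * y * b| <= s ^+ 2 + 16 * (s ^+ 2 / 10).
    have -> : 2 * y * b = w - 4 * x ^+ 3 * a by rewrite /w; ring.
    by rewrite (le_trans (ler_normB _ _))// lerD.
  rewrite !normrM (ler0_norm (_ : y <= 0)) in h; last by lra.
  rewrite (@ger0_norm _ 2)// in h.
  have := normr_ge0 b; nra.
have b2 : b ^+ 2 <= s ^+ 4 * (169 / 900).
  have -> : s ^+ 4 * (169 / 900) = (s ^+ 2 * (13 / 30)) ^+ 2 by field.
  exact: sql.
have w' : w <= s ^+ 4 / 4 by exact: le_trans (ler_norm _) w_s.
(* The increments add up to at most [1/4 + 6/100 + 1/250 + 1/10000 + 169/900 < 1] times [s^4]. *)
have -> : (x + a) ^+ 4 + (y + b) ^+ 2 = (x ^+ 4 + y ^+ 2) + w + 6 * (x * a) ^+ 2 +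
  4 * x * a ^+ 3 + a ^+ 4 + b ^+ 2 by rewrite /w; ring.
have := exprn_gt0 4 s0.
lra.
Qed.

(** The ball contains a parallelogram of half-width [c] whose vertical sections have length [2 d],
    of area [4 c d]. The product measure integrates the lengths of these sections. *)
Lemma area2_quartic_unit_ball z (s : R) :
  0 < s -> s ^+ 4 = 25 - quartic z -> z.2 <= - 3 ->
  ((s ^+ 6 / (100 * (`|z.1| + s)))%:E <= area2 (hilbert_unit_ball Om z))%E.
Proof.
move=> s0 sg y3.
have xs0 : 0 < `|z.1| + s by rewrite ltr_wpDl.
(* This half-width gives both [|x| c <= s^2 / 10] and [c <= s / 10]. *)
pose c := s ^+ 2 / (10 * (`|z.1| + s)).
have c0 : 0 < c by rewrite divr_gt0 ?exprn_gt0// mulr_gt0.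
have yl : - 5 < z.2.
  have := exprn_gt0 4 s0; rewrite sg /quartic.
  by have := sqr_ge0 (z.1 ^+ 2); rewrite -exprM; nra.
have ball v : `|v.1| <= c ->
    `|2 * z.2 * v.2 + 4 * z.1 ^+ 3 * v.1| <= s ^+ 4 / 4 ->
    hilbert_unit_ball Om z v.
  move=> vc vw.
  have h1 : `|z.1| * `|v.1| <= s ^+ 2 / 10.
    apply: le_trans (ler_wpM2l (normr_ge0 _) vc) _.
    rewrite /c mulrA ler_pdivrMr ?mulr_gt0//.
    by have := exprn_gt0 3 s0; lra.
  have h2 : `|v.1| <= s / 10.
    apply: le_trans vc _; rewrite /c ler_pdivrMr ?mulr_gt0//.
    by have := mulr_ge0 (ltW s0) (normr_ge0 z.1); lra.
  apply: hilbert_unit_ball_quartic_domain.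
  - by rewrite /Om/=; have := exprn_gt0 4 s0; lra.
  - exact: quartic_domain_add h1 h2 vw.
  - apply: (quartic_domain_add s0 sg) => //=; rewrite ?normrN//.
    by rewrite !mulrN -opprD normrN.
(* Since [|y| < 5], a vertical deviation of at most [d] changes the first-order term by at most
   [10 d = s^4 / 4]. *)
pose d := s ^+ 4 / 40.
have d0 : 0 < d by rewrite divr_gt0 ?exprn_gt0.
have sec (a : R) : `|a| <= c ->
    ((2 * d)%:E <= lebesgue_measure (xsection (hilbert_unit_ball Om z) a))%E.
  (* The section is centred on the tangent direction of the level line, where the first-order term
     vanishes. *)
  move=> ac; pose m := - (4 * z.1 ^+ 3 * a) / (2 * z.2).
  have -> : (2 * d)%:E = lebesgue_measure (`[m - d, m + d]%classic : set R).
    rewrite lebesgue_measure_itv/= lte_fin ifT; last by lra.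
    by rewrite -EFinB; congr EFin; ring.
  apply: le_lebesgue_measure => b; rewrite /= in_itv/= => /andP[b1 b2].
  rewrite /xsection/= inE; apply: ball => //=.
  have -> : 2 * z.2 * b + 4 * z.1 ^+ 3 * a = 2 * z.2 * (b - m).
    by rewrite /m; field; lra.
  rewrite !normrM (@ger0_norm _ 2)// (ler0_norm (_ : z.2 <= 0)); last lra.
  have bm : `|b - m| <= d by rewrite ler_norml; apply/andP; split; lra.
  have -> : s ^+ 4 / 4 = 2 * 5 * d by rewrite /d; field.
  by rewrite ler_pM ?mulr_ge0//; lra.
apply: (@le_trans _ _ (\int[@lebesgue_measure R]_(a in `[(- c)%R, c]) (2 * d)%:E)%E).
  rewrite integral_cst//= lebesgue_measure_itv/= lte_fin ifT; last by lra.
  rewrite -EFinB -EFinM lee_fin /d /c le_eqVlt; apply/orP; left; apply/eqP.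
  by field; lra.
apply: le_integral_ge0 => //.
  by move=> a _; rewrite lee_fin; lra.
by move=> a; rewrite /= in_itv/= -ler_norml => /sec.
Qed.

Lemma hilbert_density_quartic_domain z : Om z -> z.2 <= - 3 ->
  ((pi : R)%:E / area2 (hilbert_unit_ball Om z) <=
   (100 * pi * (`|z.1| * (25 - quartic z) `^ (- (3 / 2)) +
    (25 - quartic z) `^ (- (5 / 4))))%:E)%E.
Proof.
move=> Oz y3; set g := 25 - quartic z.
have g0 : 0 < g by rewrite subr_gt0.
pose s := g `^ 4^-1.
have s0 : 0 < s by exact: powR_gt0.
have sX n : s ^+ n = g `^ (4^-1 * n%:R).
  by rewrite -powR_mulrn ?(ltW s0)// -powRrM.
have sg : s ^+ 4 = 25 - quartic z.
  by rewrite sX mulVf// powRr1// ltW.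
have xs0 : 0 < `|z.1| + s by rewrite ltr_wpDl.
have A := area2_quartic_unit_ball s0 sg y3.
have B0 : 0 < s ^+ 6 / (100 * (`|z.1| + s)).
  by rewrite divr_gt0 ?exprn_gt0// mulr_gt0.
apply: (@le_trans _ _ ((pi : R)%:E * ((s ^+ 6 / (100 * (`|z.1| + s)))%:E)^-1)%E).
  have B0' : (0 <= (s ^+ 6 / (100 * (`|z.1| + s)))%:E)%E by rewrite lee_fin ltW.
  apply: lee_wpmul2l; first by rewrite lee_fin pi_ge0.
  by rewrite lee_pV2// inE// (le_trans B0' A).
rewrite inver gt_eqF// -EFinM lee_fin.
rewrite !powRN.
have -> : g `^ (3 / 2) = s ^+ 6 by rewrite sX; congr (_ `^ _); field.
have -> : g `^ (5 / 4) = s ^+ 5 by rewrite sX; congr (_ `^ _); field.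
rewrite le_eqVlt; apply/orP; left; apply/eqP.
by field; rewrite !gt_eqF.
Qed.

End QuarticDensity.

(** * Hilbert area of a region covered by strips above chords *)

Section QuadrilateralArea.
Context {R : realType}.
Implicit Types (z p q v : R * R).
Local Notation Om := (@quartic_domain R).

Definition slope (p q : R * R) : R := (q.2 - p.2) / (q.1 - p.1).

Definition y_intercept (p q : R * R) : R := p.2 - slope p q * p.1.

Lemma chord_lineE p q x : p.1 < q.1 -> slope p q * x + y_intercept p q =
  ((q.1 - x) * p.2 + (x - p.1) * q.2) / (q.1 - p.1).
Proof. by move=> pq; rewrite /y_intercept /slope; field; lra. Qed.

(** On the chord, [25 - quartic] vanishes at both ends, so it is [(x - p.1) (q.1 - x)] times the
    squared slope plus the divided difference of [x^4]. Above the chord, [l^2 - y^2 >= 6 (y - l)]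
    because [y] and [l] are at most -3. *)
Lemma strip_gap_le_quartic p q (k : R) z :
  p.1 < q.1 -> quartic p = 25 -> quartic q = 25 -> p.2 <= - 3 -> q.2 <= - 3 ->
  k ^+ 2 <= p.1 ^+ 2 + q.1 ^+ 2 + z.1 ^+ 2 + p.1 * q.1 + p.1 * z.1 + q.1 * z.1 ->
  p.1 <= z.1 <= q.1 -> slope p q * z.1 + y_intercept p q < z.2 < - 3 ->
  0 < strip_gap p.1 q.1 k (y_intercept p q) (slope p q) z <= 25 - quartic z.
Proof.
move=> pq p25 q25 p3 q3 hk /andP[pz zq] /andP[lz z3]; rewrite /strip_gap.
set l := slope p q * z.1 + _ in lz *; set w := (z.1 - p.1) * _.
have w0 : 0 <= w by rewrite mulr_ge0 ?subr_ge0.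
have kw : k ^+ 2 * w <= (slope p q ^+ 2 + (p.1 ^+ 2 + q.1 ^+ 2 + z.1 ^+ 2 +
    p.1 * q.1 + p.1 * z.1 + q.1 * z.1)) * w.
  by rewrite ler_wpM2r// ler_wpDl// sqr_ge0.
have E : 25 - l ^+ 2 - z.1 ^+ 4 = (slope p q ^+ 2 + (p.1 ^+ 2 + q.1 ^+ 2 + z.1 ^+ 2 +
    p.1 * q.1 + p.1 * z.1 + q.1 * z.1)) * w.
  apply/eqP; rewrite -subr_eq0; apply/eqP.
  (* The two sides differ by the linear interpolation of the values of [25 - quartic] at [p] and
     [q], both zero. *)
  transitivity (((q.1 - z.1) * (25 - quartic p) + (z.1 - p.1) * (25 - quartic q))
     / (q.1 - p.1)).
    by rewrite /quartic /l /w /y_intercept /slope; field; lra.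
  by rewrite p25 q25 subrr !mulr0 addr0 mul0r.
have l3 : l <= - 3.
  rewrite /l chord_lineE// ler_pdivrMr; last by lra.
  by nra.
have kw0 : 0 <= k ^+ 2 * w by rewrite mulr_ge0// sqr_ge0.
apply/andP; split; first by lra.
rewrite /quartic; have : 0 <= (z.2 - l) * (- (z.2 + l) - 6) by rewrite mulr_ge0; lra.
by lra.
Qed.

Definition hilbert_density z : \bar R :=
  ((pi : R)%:E / area2 (hilbert_unit_ball Om z))%E.

Lemma hilbert_density_ge0 z : (0 <= hilbert_density z)%E.
Proof.
rewrite mule_ge0 ?lee_fin ?pi_ge0// inve_ge0.
exact: integral_ge0.
Qed.

Lemma hilbert_density_strip p q (k : R) z :
  p.1 < q.1 -> quartic p = 25 -> quartic q = 25 -> p.2 <= - 3 -> q.2 <= - 3 ->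
  k ^+ 2 <= p.1 ^+ 2 + q.1 ^+ 2 + z.1 ^+ 2 + p.1 * q.1 + p.1 * z.1 + q.1 * z.1 ->
  strip p.1 q.1 (- 3) (y_intercept p q) (slope p q) z ->
  (hilbert_density z <=
   (100 * pi * strip_density p.1 q.1 k (y_intercept p q) (slope p q) z)%:E)%E.
Proof.
move=> pq p25 q25 p3 q3 hk [z1 z2].
have /andP[g0 gle] := strip_gap_le_quartic pq p25 q25 p3 q3 hk z1 z2.
have Oz : Om z by rewrite /Om/=; lra.
apply: le_trans (hilbert_density_quartic_domain Oz _) _.
  by move/andP: z2 => [_ /ltW].
rewrite lee_fin ler_wpM2l ?mulr_ge0 ?pi_ge0//.
have h e : e <= 0 -> (25 - quartic z) `^ e <=
    strip_gap p.1 q.1 k (y_intercept p q) (slope p q) z `^ e.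
  exact: le_powR_neg.
by rewrite lerD ?ler_wpM2l// h//; lra.
Qed.

Definition chord_strip p q : set (R * R) :=
  strip p.1 q.1 (- 3) (y_intercept p q) (slope p q).

(* The sum of degree 2 is the divided difference of x^4 at p.1, x, q.1, whose
   product with (x - p.1)(q.1 - x) bounds 25 - quartic from below on the chord. *)
Definition chord_scale p q (k : R) : Prop :=
  [/\ 0 < k, q.1 - p.1 <= k & forall x, p.1 <= x <= q.1 -> `|x| <= k /\
    k ^+ 2 <= p.1 ^+ 2 + q.1 ^+ 2 + x ^+ 2 + p.1 * q.1 + p.1 * x + q.1 * x].

(** Additivity of the integral asks for measurable functions; the majorants, extended by zero
    outside the strip, provide them in place of the density itself. *)
Lemma chord_strip_majorant p q (k : R) :
  p.1 < q.1 -> quartic p = 25 -> quartic q = 25 -> p.2 <= - 3 -> q.2 <= - 3 ->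
  chord_scale p q k ->
  exists g : R * R -> \bar R,
    [/\ measurable_fun setT g, forall z, (0 <= g z)%E,
        (\int[@lebesgue_measure R \x @lebesgue_measure R]_z g z <=
          (100 * pi * (1 + pi))%:E)%E &
        forall z, chord_strip p q z -> (hilbert_density z <= g z)%E].
Proof.
move=> pq p25 q25 p3 q3 [k0 pqk hk].
pose h := (fun z => (strip_density p.1 q.1 k (y_intercept p q) (slope p q) z)%:E)
  \_ (chord_strip p q).
have h0 z : (0 <= h z)%E.
  by apply: erestrict_ge0 => z' _; rewrite lee_fin strip_density_ge0.
have mh : measurable_fun [set: R * R] h := measurable_strip_density_patch _ _ _ _ _ _.
have c0 : 0 <= 100 * pi :> R by rewrite mulr_ge0 ?pi_ge0.
exists (fun z => (100 * pi)%:E * h z)%E; split.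
- exact: measurable_funeM.
- by move=> z; rewrite mule_ge0// lee_fin.
- rewrite ge0_integralZl_EFin//.
  rewrite (EFinM (100 * pi)) lee_wpmul2l ?lee_fin// -integral_mkcond.
  apply: integral_chord_strip => // x /andP[px xq].
  by have [] := hk x ltac:(lra).
- move=> z sz; rewrite /h patchE mem_set// -EFinM.
  apply: hilbert_density_strip => //.
  by case: sz => /hk[].
Qed.

(** At each point of [S] one of the three majorants dominates the density, hence so does their
    sum. *)
Lemma hilbert_area_chord_strips p q r s (S : set (R * R)) (k1 k2 k3 : R) :
  [/\ quartic p = 25, quartic q = 25, quartic r = 25 & quartic s = 25] ->
  [/\ p.2 <= - 3, q.2 <= - 3, r.2 <= - 3 & s.2 <= - 3] ->
  [/\ p.1 < q.1, q.1 < r.1 & r.1 < s.1] ->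
  S `<=` chord_strip p q `|` chord_strip q r `|` chord_strip r s ->
  chord_scale p q k1 -> chord_scale q r k2 -> chord_scale r s k3 ->
  (hilbert_area Om S <= (3 * (100 * pi * (1 + pi)))%:E)%E.
Proof.
move=> [p25 q25 r25 s25] [p3 q3 r3 s3] [pq qr rs] SU hk1 hk2 hk3.
have [g1 [m1 g10 i1 h1]] := chord_strip_majorant pq p25 q25 p3 q3 hk1.
have [g2 [m2 g20 i2 h2]] := chord_strip_majorant qr q25 r25 q3 r3 hk2.
have [g3 [m3 g30 i3 h3]] := chord_strip_majorant rs r25 s25 r3 s3 hk3.
apply: (@le_trans _ _ (\int[@lebesgue_measure R \x @lebesgue_measure R]_z
   (g1 z + g2 z + g3 z))%E).
  apply: le_integral_ge0 => z.
  - by move=> _; exact: hilbert_density_ge0.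
  - by move=> _; rewrite !adde_ge0.
  - move=> /SU Sz; split => //; case: Sz => [[/h1|/h2]|/h3] /le_trans; apply.
    + by rewrite -addeA leeDl// adde_ge0.
    + by rewrite addeAC leeDr// adde_ge0.
    + by rewrite leeDr// adde_ge0.
rewrite ge0_integralD//; last 2 first.
- by move=> z _; rewrite adde_ge0.
- exact: emeasurable_funD.
rewrite ge0_integralD//.
have -> : 3 * (100 * pi * (1 + pi)) = 100 * pi * (1 + pi) + 100 * pi * (1 + pi) +
  100 * pi * (1 + pi) :> R by ring.
by rewrite !EFinD; apply: leeD => //; apply: leeD.
Qed.

Lemma quadrilateral_halfplane A B C D (l m n : R) z :
  l * A.1 + m * A.2 <= n -> l * B.1 + m * B.2 <= n ->
  l * C.1 + m * C.2 <= n -> l * D.1 + m * D.2 <= n ->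
  quadrilateral A B C D z -> l * z.1 + m * z.2 <= n.
Proof.
move=> hA hB hC hD [r1 [r2 [r3 [r4 [[r10 r20 r30 r40] r1E ->]]]]].
rewrite /= /GRing.scale/=.
have := ler_wpM2l r10 hA; have := ler_wpM2l r20 hB.
have := ler_wpM2l r30 hC; have := ler_wpM2l r40 hD.
have : n = (r1 + r2 + r3 + r4) * n by rewrite r1E mul1r.
lra.
Qed.

(** Turns the weak inequalities valid on a quadrilateral into strict ones on its interior. *)
Lemma interior_vertical (S : set (R * R)) z : interior S z ->
  exists2 e : R, 0 < e & S (z.1, z.2 - e) /\ S (z.1, z.2 + e).
Proof.
move=> /nbhs_ballP[e/= e0 zS]; exists (e / 2); first by rewrite divr_gt0.
have b (d : R) : `|d| < e -> ball z e (z.1, z.2 + d).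
  move=> de; split => /=; first exact: ballxx.
  by rewrite /ball/= opprD addrA subrr add0r normrN.
split; apply: zS; apply: b; rewrite ?normrN gtr0_norm; lra.
Qed.

End QuadrilateralArea.

(** * Smoothness of the boundary *)

Section QuarticBoundary.
Context {R : realType}.
Implicit Types (z p q v : R * R).
Local Notation Om := (@quartic_domain R).

(** Functions [c + P u^b] with polynomials [P] and [u] are stable under differentiation, the
    exponent dropping by 1. The summand 0 is the new constant. *)
Lemma is_derive_powR_poly (u P : {poly R}) (b c s : R) : 0 < u.[s] ->
  is_derive s 1 (fun s => c + P.[s] * u.[s] `^ b)
    (0 + (P^`() * u + b *: (P * u^`())).[s] * u.[s] `^ (b - 1)).
Proof.
move=> us0.
have du := @is_derive1_comp _ (fun z : R => z `^ b) (horner u) s _ _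
  (is_derive1_powR b us0) (is_derive_poly u s).
have := is_deriveD (is_derive_cst c s 1) (is_deriveM (is_derive_poly P s) du).
move=> /is_derive_eq; apply; rewrite /GRing.scale/= add0r hornerD !(hornerM, hornerZ).
have -> : u.[s] `^ b = u.[s] * u.[s] `^ (b - 1).
  rewrite -{2}(powRr1 (ltW us0)) -powRD; last by rewrite (gt_eqF us0) implybT.
  by congr (_ `^ _); ring.
by ring.
Qed.

Lemma near_norm_lt (s delta : R) :
  `|s| < delta -> \forall t \near s, `|t| < delta.
Proof. by move=> sd; exact: (@cvgr_norm_lt R R R (nbhs s) _ id s _ delta sd). Qed.

Lemma derive1n_powR_poly (u : {poly R}) (a c delta : R) k :
  (forall s, `|s| < delta -> 0 < u.[s]) ->
  exists (c' : R) (P : {poly R}), forall s, `|s| < delta ->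
    derive1n k (fun s => c - u.[s] `^ a) s = c' + P.[s] * u.[s] `^ (a - k%:R).
Proof.
move=> u0; elim: k => [|k [c' [P IH]]].
  by exists c, (- 1) => s _ /=; rewrite !hornerE subr0; ring.
exists 0, (P^`() * u + (a - k%:R) *: (P * u^`())) => s sd.
have := is_derive_powR_poly P (a - k%:R) c' (u0 _ sd).
(* The formula for the [k]-th derivative holds only for [|s| < delta], which suffices as
   differentiation is local. *)
move=> /(@near_eq_is_derive _ _ _ _ (derive1n k (fun s => c - u.[s] `^ a)))h.
have {}h := h _; rewrite derive1nS derive1E.
rewrite (_ : a - k.+1%:R = a - k%:R - 1); last by rewrite -natr1; ring.
apply: derive_val; apply: h.
near=> t; rewrite IH//; near: t.
exact: near_norm_lt.
Unshelve. all: by end_near. Qed.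

Lemma smooth_near0_powR (u : {poly R}) (a c delta : R) :
  (forall s, `|s| < delta -> 0 < u.[s]) ->
  smooth_near0 delta (fun s => c - u.[s] `^ a).
Proof.
move=> u0 k s sd; have [c' [P E]] := derive1n_powR_poly a c k u0.
have [+ _] := is_derive_powR_poly P (a - k%:R) c' (u0 _ sd).
apply: near_eq_derivable.
near=> t; rewrite E//; near: t.
exact: near_norm_lt.
Unshelve. all: by end_near. Qed.

Lemma is_derive_pair (f g : R -> R) (x df dg : R) :
  is_derive x 1 f df -> is_derive x 1 g dg ->
  is_derive x 1 (fun t => (f t, g t)) (df, dg).
Proof.
move=> [fx <-] [gx <-].
have fd : differentiable f x by exact/derivable1_diffP.
have gd : differentiable g x by exact/derivable1_diffP.
apply: DeriveDef; first exact/diff_derivable/differentiable_pair.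
by rewrite deriveE ?diff_pair//= ?deriveE//; exact: differentiable_pair.
Qed.


(** The constant [c] is also the radius in [t], so [c - t] stays positive and its comparison with a
    root can be raised to a power. *)
Lemma quartic_domain_smooth_chart p (e1 e2 : R * R) (u : {poly R}) (a c delta : R) :
  det2 e1 e2 != 0 -> 0 < delta -> 0 < c ->
  (forall s, `|s| < delta -> 0 < u.[s]) ->
  (forall s t, `|s| < delta -> `|t| < c ->
     (Om (p + s *: e1 + t *: e2) <-> c - t < u.[s] `^ a)) ->
  exists (e1 e2 : R * R) (delta eps : R) (f : R -> R),
      [/\ det2 e1 e2 != 0, 0 < delta, 0 < eps, smooth_near0 delta f &
        forall s t : R, `|s| < delta -> `|t| < eps ->
          (Om (p + s *: e1 + t *: e2) <-> f s < t)].
Proof.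
move=> e12 d0 c0 u0 H; exists e1, e2, delta, c, (fun s => c - u.[s] `^ a); split=> //.
  exact: smooth_near0_powR.
by move=> s t sd tc; rewrite H// ltrBlDr ltrBlDl; split.
Qed.

Lemma lt_powR_inv (x y : R) (n : nat) : (0 < n)%N -> 0 <= x -> 0 < y ->
  (x < y `^ (n%:R^-1)) = (x ^+ n < y).
Proof.
move=> n0 x0 y0; have yn : y = (y `^ (n%:R^-1)) ^+ n.
  by rewrite -powR_mulrn ?powR_ge0// -powRrM mulVf ?pnatr_eq0 -?lt0n// powRr1// ltW.
by rewrite [in RHS]yn ltr_pXn2r ?nnegrE ?powR_ge0.
Qed.

(** Where [y = 0] the tangent is vertical, and [|x|] is the fourth root of [25 - y^2]; elsewhere
    [|y|] is the square root of [25 - x^4]. The sign in the second axis makes it point inwards. *)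
Lemma quartic_domain_smooth_boundary : smooth_boundary Om.
Proof.
move=> p /boundary_quartic_domain; case: p => x y; rewrite /quartic/= => pE.
have [y0|y0] := eqVneq y 0.
  have x0 : 0 < `|x|.
    rewrite normr_gt0; apply/eqP => x0; move: pE; rewrite x0 y0 !expr0n/=; lra.
  have xs : x = Num.sg x * `|x| by rewrite -numEsg.
  have sg2 : Num.sg x ^+ 2 = 1 by rewrite sqr_sg -normr_gt0 x0.
  apply: (@quartic_domain_smooth_chart _ (0, 1) (- Num.sg x, 0) (25%:P - 'X^2)
    4%:R^-1 `|x| 5) => //.
  - rewrite /det2/= mul0r sub0r mulrN opprK mul1r sgr_eq0 -normr_gt0//.
  - by move=> s; rewrite ltr_norml => /andP[? ?]; rewrite !hornerE; nra.
  - move=> s t; rewrite !ltr_norml => /andP[s1 s2] /andP[t1 t2].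
    rewrite lt_powR_inv//; [|by rewrite subr_ge0 ltW|by rewrite !hornerE; nra].
    rewrite /Om /quartic/= /GRing.scale/= y0.
    have -> : x + s * 0 + t * - Num.sg x = Num.sg x * (`|x| - t).
      by rewrite {1}xs; ring.
    rewrite exprMn (_ : Num.sg x ^+ 4 = 1); last first.
      by rewrite (exprM _ 2 2) sg2 expr1n.
    by rewrite !hornerE; split; lra.
have x5 : x ^+ 4 < 25.
  by have : 0 < y ^+ 2; [rewrite exprn_even_gt0|lra].
have yp : 0 < `|y| by rewrite normr_gt0.
have ys : y = Num.sg y * `|y| by rewrite -numEsg.
have sg2 : Num.sg y ^+ 2 = 1 by rewrite sqr_sg y0.
have [delta d0 hd] : exists2 delta, 0 < delta & forall s, `|s| < delta ->
    0 < (25%:P - ('X + x%:P) ^+ 4).[s].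
  have cu : {for 0, continuous (horner (25%:P - ('X + x%:P) ^+ 4))}.
    exact: continuous_horner.
  have /nbhs_ballP[d/= d0 h] : \forall s \near 0, 0 < (25%:P - ('X + x%:P) ^+ 4).[s].
    by apply: (cvgr_gt _ cu); rewrite !hornerE; lra.
  exists d => // s sd; apply: h; rewrite /ball/= sub0r normrN//.
apply: (@quartic_domain_smooth_chart _ (1, 0) (0, - Num.sg y) (25%:P - ('X + x%:P) ^+ 4)
    2%:R^-1 `|y| delta) => //.
- by rewrite /det2/= mul0r subr0 mul1r oppr_eq0 sgr_eq0.
- move=> s t sd; rewrite !ltr_norml => /andP[t1 t2].
  rewrite lt_powR_inv//; [|by rewrite subr_ge0 ltW|exact: hd].
  rewrite /Om /quartic/= /GRing.scale/=.
  have -> : y + s * 0 + t * - Num.sg y = Num.sg y * (`|y| - t).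
    by rewrite {1}ys; ring.
  rewrite (exprMn 2) sg2.
  have -> : x + s * 1 + t * 0 = s + x by ring.
  by rewrite !hornerE; split; lra.
Qed.

End QuarticBoundary.

(** * The inscribed quadrilaterals *)

Section Quadrilaterals.
Context {R : realType}.
Implicit Types (z p q v : R * R).
Local Notation Om := (@quartic_domain R).

Definition lower_arc (x : R) : R * R := (x, - Num.sqrt (25 - x ^+ 4)).

Lemma quartic_lower_arc x : x ^+ 4 <= 25 -> quartic (lower_arc x) = 25.
Proof. by move=> x25; rewrite /quartic/= sqrrN sqr_sqrtr ?subr_ge0//; ring. Qed.

Lemma tangent_line_lower_arc x : x ^+ 4 < 25 ->
  tangent_line Om (lower_arc x)
    (line (lower_arc x) (1, 2 * x ^+ 3 / Num.sqrt (25 - x ^+ 4))).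
Proof.
move=> x25; have s0 : 0 < Num.sqrt (25 - x ^+ 4) by rewrite sqrtr_gt0 subr_gt0.
exists (fun t => lower_arc (x + t)), (1, 2 * x ^+ 3 / Num.sqrt (25 - x ^+ 4)).
pose u : {poly R} := 25%:P - (x%:P + 'X) ^+ 4.
have uE t : u.[t] = 25 - (x + t) ^+ 4 by rewrite /u !hornerE.
split => //.
- by rewrite addr0.
- have : \forall t \near 0, 0 < u.[t].
    have cu : {for 0, continuous (horner u)} by exact: continuous_horner.
    by apply: (cvgr_gt _ cu); rewrite uE addr0 subr_gt0.
  apply: filterS => t; rewrite uE subr_gt0 => /ltW xt.
  exact/boundary_quartic_domain/quartic_lower_arc.
- apply: is_derive_pair.
    by apply: is_derive_eq; rewrite add0r.
  have u0 : 0 < u.[0] by rewrite uE addr0 subr_gt0.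
  have ds := @is_derive1_comp _ Num.sqrt (horner u) 0 _ _
    (is_derive1_sqrt u0) (is_derive_poly u 0).
  have {ds} := is_deriveN ds.
  have -> : (- (Num.sqrt \o horner u)) = (fun t => - Num.sqrt (25 - (x + t) ^+ 4)).
    by apply/funext => t /=; rewrite -uE.
  move=> /is_derive_eq; apply; rewrite uE addr0.
  have -> : u^`().[0] = - 4 * x ^+ 3.
    rewrite /u derivB derivC deriv_exp derivD derivC derivX !hornerE /=.
    by ring.
  by field; rewrite gt_eqF.
- by rewrite xpair_eqE oner_eq0.
Qed.

(** The transversal is the vertical line one unit to the right of [p]: a line through [p] meets it
    at a height equal to its slope. *)
Lemma slopes_cross_ratio p v1 v2 v3 v4 (k : R) :
  [/\ v1.1 != 0, v2.1 != 0, v3.1 != 0 & v4.1 != 0] ->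
  k = cross_ratio (v1.2 / v1.1) (v2.2 / v2.1) (v3.2 / v3.1) (v4.2 / v4.1) ->
  is_lines_cross_ratio p (line p v1) (line p v2) (line p v3) (line p v4) k.
Proof.
move=> [h1 h2 h3 h4] ->.
have l0 v : line p v p by exists 0; rewrite scale0r addr0.
split; first by split.
have l v : v.1 != 0 -> line p v (p + (1, 0) + (v.2 / v.1) *: (0, 1)).
  move=> v0; exists (v.1)^-1; clear l0; case: p v v0 => [a b] [c d]/= c0.
  congr pair; rewrite /= /GRing.scale/=; first by field.
  by field.
exists (p + (1, 0)), (0, 1), (v1.2 / v1.1), (v2.2 / v2.1), (v3.2 / v3.1), (v4.2 / v4.1).
split=> //.
- by rewrite xpair_eqE oner_eq0 andbF.
- move=> [t]; case: p {l0 l} => a b [] /= /eqP; rewrite /GRing.scale/= mulr0 addr0.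
  by move=> /eqP; lra.
- by split; apply: l.
Qed.

Lemma interior_quadrilateral_above_chord A B C D p q z : p.1 < q.1 ->
  (forall V, V \in [:: A; B; C; D] ->
    (q.1 - V.1) * p.2 + (V.1 - p.1) * q.2 <= V.2 * (q.1 - p.1)) ->
  interior (quadrilateral A B C D) z -> slope p q * z.1 + y_intercept p q < z.2.
Proof.
move=> pq H /interior_vertical[e e0 [Q _]].
have h V : V \in [:: A; B; C; D] ->
    slope p q * V.1 + - 1 * V.2 <= - y_intercept p q.
  move=> /H VH; have := chord_lineE V.1 pq.
  rewrite -ler_pdivrMr ?subr_gt0// in VH; lra.
have := quadrilateral_halfplane (h A _) (h B _) (h C _) (h D _) Q.
by rewrite !inE !eqxx !orbT /= => /(_ isT isT isT isT); lra.
Qed.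

Definition vertexA : R * R := (0, - 5).
Definition vertexB : R * R := (2, - 3).
Definition vertexC : R * R := (- 2, - 3).
Definition vertexD (e : R) : R * R := lower_arc (- e).

(** The third bound comes from [5 - s = e^4 / (5 + s)] and [s > 4]. *)
Lemma sqrt_quadrilateral_vertex (e : R) : 0 < e <= 1 ->
  let s := Num.sqrt (25 - (- e) ^+ 4) in
  [/\ s ^+ 2 = 25 - e ^+ 4, 4 < s, 5 - s <= e ^+ 4 / 9 & 0 < 5 - s].
Proof.
move=> /andP[e0 e1] s.
have e40 : 0 < e ^+ 4 by rewrite exprn_gt0.
have e41 : e ^+ 4 <= 1 by rewrite exprn_ile1 ?(ltW e0).
have s0 : 0 <= s by exact: sqrtr_ge0.
have s2 : s ^+ 2 = 25 - e ^+ 4.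
  by rewrite sqr_sqrtr exprNn (exprM _ 2 2) sqrrN !expr1n mul1r//; lra.
have s4 : 4 < s by nra.
have s5 : s < 5 by nra.
by split => //; nra.
Qed.

Lemma hilbert_area_quadrilateral (e : R) : 0 < e <= 1 ->
  (hilbert_area Om (interior (quadrilateral vertexA vertexB vertexC (vertexD e)))
   <= (3 * (100 * pi * (1 + pi)))%:E)%E.
Proof.
move=> e01; have [s2 s4 s9 s5] := sqrt_quadrilateral_vertex e01.
have /andP[e0 e1] := e01.
set s := Num.sqrt _ in s2 s4 s9 s5.
have e4e : e ^+ 4 <= e by rewrite -[leRHS]expr1 ler_wiXn2l// ltW.
(* From left to right the vertices are C, D, A, B; each scale is the largest absolute abscissa on
   its chord. *)
apply: (@hilbert_area_chord_strips _ vertexC (vertexD e) vertexA vertexB _ 2 e 2).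
- split; rewrite ?quartic_lower_arc//; rewrite /quartic/=; try ring.
  by rewrite exprNn (exprM _ 2 2) sqrrN !expr1n mul1r; lra.
- by split => /=; rewrite -/s; lra.
- by split => /=; lra.
- move=> z Qz.
  have := @interior_quadrilateral_above_chord _ _ _ _ vertexC (vertexD e) z _ _ Qz.
  have := @interior_quadrilateral_above_chord _ _ _ _ (vertexD e) vertexA z _ _ Qz.
  have := @interior_quadrilateral_above_chord _ _ _ _ vertexA vertexB z _ _ Qz.
  have V3 V : V \in [:: vertexA; vertexB; vertexC; vertexD e] ->
     [\/ V = vertexA, V = vertexB, V = vertexC | V = (- e, - s)].
    by rewrite !inE => /or4P[] /eqP ->; [constructor 1|constructor 2|constructor 3|constructor 4].
  move=> h1 h2 h3.
  have {}h1 : slope vertexA vertexB * z.1 + y_intercept vertexA vertexB < z.2.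
    by apply: h1 => [/=|V /V3[] -> /=]; nra.
  have {}h2 : slope (vertexD e) vertexA * z.1 + y_intercept (vertexD e) vertexA < z.2.
    by apply: h2 => [/=|V /V3[] -> /=]; rewrite -?/s; nra.
  have {}h3 : slope vertexC (vertexD e) * z.1 + y_intercept vertexC (vertexD e) < z.2.
    by apply: h3 => [/=|V /V3[] -> /=]; rewrite -?/s; nra.
  (* The point raised by [d] still satisfies [y <= - 3], so [z.2 < - 3]. *)
  have [d d0 [_ Qd]] := interior_vertical Qz.
  have hp l m n hA hB hC hD := @quadrilateral_halfplane R vertexA vertexB vertexC
    (vertexD e) l m n _ hA hB hC hD Qd.
  have /= zl := hp 1 0 2 ltac:(rewrite /=; lra)
    ltac:(rewrite /=; lra) ltac:(rewrite /=; lra) ltac:(rewrite /=; lra).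
  have /= zr := hp (- 1) 0 2 ltac:(rewrite /=; lra)
    ltac:(rewrite /=; lra) ltac:(rewrite /=; lra) ltac:(rewrite /=; lra).
  have /= zt := hp 0 1 (- 3) ltac:(rewrite /=; lra)
    ltac:(rewrite /=; lra) ltac:(rewrite /=; lra) ltac:(rewrite /= -/s; lra).
  have z3 : z.2 < - 3 by lra.
  have [z0|z0] := leP 0 z.1.
    by right; split => /=; [apply/andP; split; lra|apply/andP; split].
  left; have [ze|ze] := leP (- e) z.1.
    by right; split => /=; [apply/andP; split; lra|apply/andP; split].
  by left; split => /=; [apply/andP; split; lra|apply/andP; split].
- split => [//|/=|x /= /andP[x1 x2]]; first by lra.
  by split; [rewrite ler_norml; apply/andP; split; lra|nra].
- split => [//|/=|x /= /andP[x1 x2]]; first by lra.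
  by split; [rewrite ler_norml; apply/andP; split; lra|nra].
- split => [//|/=|x /= /andP[x1 x2]]; first by lra.
  by split; [rewrite ler_norml; apply/andP; split; lra|nra].
Qed.

End Quadrilaterals.

(** * Edge parameters and divergence of their ratio *)

Section BulgeDivergence.
Context {R : realType}.

(** The height of D above A, of order [e^4]. *)
Definition depthD (e : R) : R := 5 - Num.sqrt (25 - (- e) ^+ 4).

(** The lines through A have slopes 0, 1, -1 and [- depthD e / e]. *)
Definition edgeZ (e : R) : R := (e - depthD e) / (2 * depthD e).

(** The lines through C have slopes [- 16 / 3], [- sigma], -1 and 0; [sigma] tends to 1 as D tends
    to A. *)
Definition edgeW (e : R) : R :=
  let sigma := (2 - depthD e) / (2 - e) in
  (16 / 3 - sigma) / (16 / 3 * (sigma - 1)).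

Lemma ccw4_quadrilateral (e : R) : 0 < e <= 1 ->
  ccw4 vertexA vertexB vertexC (vertexD e).
Proof.
move=> e01; have [s2 s4 s9 s5] := sqrt_quadrilateral_vertex e01.
have /andP[e0 e1] := e01; set s := Num.sqrt _ in s2 s4 s9 s5.
have e4e : e ^+ 4 <= e by rewrite -[leRHS]expr1 ler_wiXn2l// ltW.
by split; rewrite /ccw3 /det2/= -?/s; nra.
Qed.

Lemma edge_parameters_quadrilateral (e : R) : 0 < e <= 1 ->
  edge_parameters vertexA vertexB vertexC (vertexD e)
    (line (lower_arc 0) (1, 2 * 0 ^+ 3 / Num.sqrt (25 - 0 ^+ 4)))
    (line (lower_arc (- 2)) (1, 2 * (- 2) ^+ 3 / Num.sqrt (25 - (- 2) ^+ 4)))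
    (edgeZ e) (edgeW e).
Proof.
move=> e01; have [s2 s4 s9 s5] := sqrt_quadrilateral_vertex e01.
have /andP[e0 e1] := e01.
have sq (x : R) : 0 <= x -> Num.sqrt (x ^+ 2) = x.
  by move=> x0; rewrite sqrtr_sqr ger0_norm.
have s25 : Num.sqrt (25 - 0 ^+ 4) = 5 :> R.
  by rewrite (_ : 25 - 0 ^+ 4 = 5 ^+ 2) ?sq//; ring.
have s9' : Num.sqrt (25 - (- 2) ^+ 4) = 3 :> R.
  by rewrite (_ : 25 - (- 2) ^+ 4 = 3 ^+ 2) ?sq//; ring.
have -> : lower_arc 0 = vertexA :> R * R by rewrite /lower_arc s25.
have -> : lower_arc (- 2) = vertexC :> R * R by rewrite /lower_arc s9'.
have e4e : e ^+ 4 <= e by rewrite -[leRHS]expr1 ler_wiXn2l// ltW.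
split.
- apply: slopes_cross_ratio; first by split; rewrite /=; lra.
  rewrite /edgeZ /cross_ratio /depthD /=.
  set s := Num.sqrt (25 - (- e) ^+ 4) in s2 s4 s9 s5 *.
  by field; repeat (apply/andP; split); lra.
- rewrite s9'; apply: slopes_cross_ratio; first by split; rewrite /=; lra.
  rewrite /edgeW /cross_ratio /depthD /=.
  set s := Num.sqrt (25 - (- e) ^+ 4) in s2 s4 s9 s5 *.
  by field; repeat (apply/andP; split); lra.
Qed.

(** Both sides are compared with [2 / (e - d)]. The second comparison amounts to
    [4 d <= e (e - d)^2], which follows from [d <= e^4 / 9] and [e - d >= 8 e / 9]. *)
Lemma edge_ratio (e : R) : 0 < e <= 1 -> 0 < edgeW e /\ edgeW e <= e * edgeZ e.
Proof.
move=> e01; have [s2 s4 s9 s5] := sqrt_quadrilateral_vertex e01.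
have /andP[e0 e1] := e01; rewrite /edgeZ /edgeW /depthD.
set d := 5 - Num.sqrt _ in s9 s5 *; set sigma := (2 - d) / (2 - e).
have e4e : e ^+ 4 <= e by rewrite -[leRHS]expr1 ler_wiXn2l// ltW.
have e42 : e ^+ 4 <= e ^+ 2 by rewrite ler_wiXn2l// ltW.
have sig : sigma - 1 = (e - d) / (2 - e) by rewrite /sigma; field; lra.
have sig1 : 0 < sigma - 1 by rewrite sig divr_gt0; lra.
have sig2 : sigma <= 2 by rewrite /sigma ler_pdivrMr; lra.
split; first by rewrite divr_gt0 ?mulr_gt0; lra.
apply: (@le_trans _ _ (2 / (e - d))).
  rewrite ler_pdivrMr; last by rewrite mulr_gt0//; lra.
  rewrite sig (_ : 2 / (e - d) * _ = 2 * (16 / 3) / (2 - e)); last first.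
    by field; repeat (apply/andP; split); lra.
  rewrite ler_pdivlMr; last by lra.
  by nra.
rewrite ler_pdivrMr; last by lra.
rewrite mulrA mulrAC ler_pdivlMr; last by lra.
have h : 8 / 9 * e <= e - d by lra.
have h2 : (8 / 9 * e) ^+ 2 <= (e - d) ^+ 2 by rewrite ler_sqr ?nnegrE; lra.
have h3 : 2 * (2 * d) <= 4 / 9 * (e * e ^+ 2).
  have : e ^+ 4 <= e * e ^+ 2 by rewrite -exprS ler_wiXn2l// ltW.
  by lra.
have := ler_wpM2l (ltW e0) h2.
nra.
Qed.

End BulgeDivergence.

Theorem proposition8 (R : realType) (Z0 W0 : R) (hZ0 : 0 < Z0) (hW0 : 0 < W0) :
  exists (Omega : nat -> set (R * R)) (A B C D : nat -> R * R)
         (a b c d : nat -> set (R * R)) (Z W u v : nat -> R),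
    (forall n, smooth_strictly_convex_domain (Omega n)) /\
    (forall n, [/\ boundary (Omega n) (A n), boundary (Omega n) (B n),
                   boundary (Omega n) (C n) & boundary (Omega n) (D n)]) /\
    (forall n, ccw4 (A n) (B n) (C n) (D n)) /\
    (forall n, [/\ tangent_line (Omega n) (A n) (a n),
                   tangent_line (Omega n) (B n) (b n),
                   tangent_line (Omega n) (C n) (c n) &
                   tangent_line (Omega n) (D n) (d n)]) /\
    (forall n, edge_parameters (A n) (B n) (C n) (D n) (a n) (c n)
                 (Z n) (W n)) /\
    (forall n, twist_bulge_parameters Z0 W0 (Z n) (W n) (u n) (v n)) /\
    (exists M : R, forall n,
       (hilbert_area (Omega n)
          (interior (quadrilateral (A n) (B n) (C n) (D n))) <= M%:E)%E) /\
    (`|v n| @[n --> \oo] --> +oo).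
Proof.
pose e n : R := n.+1%:R^-1.
have e01 n : 0 < e n <= 1.
  by rewrite invr_gt0 ltr0n/= invf_le1 ?ltr0n// ler1n.
pose l x := line (lower_arc x) (1, 2 * x ^+ 3 / Num.sqrt (25 - x ^+ 4)) : set (R * R).
pose z n := ln (edgeZ (e n) / Z0); pose w n := ln (edgeW (e n) / W0).
have W_gt0 n : 0 < edgeW (e n) by have [] := edge_ratio (e01 n).
have Z_gt0 n : 0 < edgeZ (e n).
  have [Wn /(lt_le_trans Wn)] := edge_ratio (e01 n).
  by have /andP[en _] := e01 n; rewrite pmulr_rgt0.
have q (x : R) : x ^+ 4 < 25 -> boundary (@quartic_domain R) (lower_arc x).
  by move=> /ltW x25; apply/boundary_quartic_domain/quartic_lower_arc.
have x0 : (0 : R) ^+ 4 < 25 by lra.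
have x2 : (2 : R) ^+ 4 < 25 by lra.
have xm2 : (- 2 : R) ^+ 4 < 25 by lra.
have xe n : (- e n) ^+ 4 < 25.
  have /andP[en0 en1] := e01 n; have := exprn_ile1 4 (ltW en0) en1.
  by rewrite (_ : (- e n) ^+ 4 = e n ^+ 4); [lra|ring].
have sq (x : R) : 0 <= x -> Num.sqrt (x ^+ 2) = x.
  by move=> h; rewrite sqrtr_sqr ger0_norm.
have EA : vertexA = lower_arc 0 :> R * R.
  by rewrite /lower_arc (_ : 25 - 0 ^+ 4 = 5 ^+ 2) ?sq//; ring.
have EB : vertexB = lower_arc 2 :> R * R.
  by rewrite /lower_arc (_ : 25 - 2 ^+ 4 = 3 ^+ 2) ?sq//; ring.
have EC : vertexC = lower_arc (- 2) :> R * R.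
  by rewrite /lower_arc (_ : 25 - (- 2) ^+ 4 = 3 ^+ 2) ?sq//; ring.
exists (fun=> @quartic_domain R), (fun=> vertexA), (fun=> vertexB), (fun=> vertexC),
  (fun n => vertexD (e n)), (fun=> l 0), (fun=> l 2), (fun=> l (- 2)),
  (* The last two witnesses solve [u - 3 v = z] and [u + 3 v = w]. *)
  (fun n => l (- e n)), (fun n => edgeZ (e n)), (fun n => edgeW (e n)),
  (fun n => (z n + w n) / 2), (fun n => (w n - z n) / 6).
split; [|split; [|split; [|split; [|split; [|split; [|split]]]]]].
- move=> n; split.
  + exact: open_quartic_domain.
  + by exists 0; rewrite /quartic_domain/= /quartic/= !expr0n/=; lra.
  + exact: quartic_domain_bounded.
  + exact: quartic_domain_strictly_convex.
  + exact: quartic_domain_smooth_boundary.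
- by move=> n; rewrite EA EB EC; split; apply: q.
- by move=> n; exact: ccw4_quadrilateral.
- by move=> n; rewrite EA EB EC; split; apply: tangent_line_lower_arc.
- by move=> n; exact: edge_parameters_quadrilateral.
- have E (x y : R) : 0 < x -> 0 < y -> x = expR (ln (x / y)) * y.
    by move=> x1 y1; rewrite lnK ?posrE ?divr_gt0// mulfVK// gt_eqF.
  move=> n; split.
    by rewrite (_ : _ - _ = z n) -?E//; field.
  by rewrite (_ : _ + _ = w n) -?E//; field.
- by exists (3 * (100 * pi * (1 + pi))) => n; exact: hilbert_area_quadrilateral.
- apply/cvgryPge => M.
  near=> n.
  have [_ WZ] := edge_ratio (e01 n).
  (* Since [v = (w - z) / 6], the bound [|v| >= M] follows from [z - w >= 6 M], here in exponential
     form. It holds for large [n] because [Z / W >= n + 1]. *)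
  have ratio : expR (6 * M) <= edgeZ (e n) / Z0 / (edgeW (e n) / W0).
    have N : expR (6 * M) * Z0 / W0 <= n.+1%:R.
      apply: (@le_trans _ _ n%:R); last by rewrite ler_nat.
      by near: n; exact: nbhs_infty_ger.
    have NZW : n.+1%:R <= edgeZ (e n) / edgeW (e n).
      rewrite ler_pdivlMr//.
      by move: WZ; rewrite /e mulrC ler_pdivlMr ?ltr0n// mulrC.
    rewrite (_ : edgeZ _ / Z0 / _ = edgeZ (e n) / edgeW (e n) * (W0 / Z0)); last first.
      by field; rewrite !gt_eqF.
    rewrite -ler_pdivrMr ?divr_gt0//.
    by rewrite invf_div mulrA (le_trans N).
  have : 6 * M <= z n - w n.
    have ZZ : 0 < edgeZ (e n) / Z0 by rewrite divr_gt0.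
    have WW : 0 < edgeW (e n) / W0 by rewrite divr_gt0.
    rewrite /z /w -ln_div ?posrE// -(ler_expR (6 * M)) lnK// posrE.
    exact: divr_gt0.
  rewrite -normrN => h; apply: le_trans (ler_norm _); lra.
Unshelve. all: by end_near. Qed.
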